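(* Let $K\subset\mathbb{R}^2$ be a convex body and write $r=r(K)$, $w=w(K)$, $D=D(K)$, $R=R(K)$. Then \[ w\ \le\ r\left(1+\frac{2\sqrt{2}\,R}{D}\sqrt{1+\sqrt{1-\left(\frac{D}{2R}\right)^2}}\right). \]
   Context: For a convex body $K\subset\mathbb{R}^n$: $D(K)$ is the largest distance between two points of $K$; $w(K)$ is the smallest distance between two distinct parallel supporting lines/hyperplanes of $K$; $r(K)$ is the radius of a largest Euclidean ball contained in $K$; $R(K)$ is the radius of the smallest Euclidean ball containing $K$. *)

(* Defs.v *)
From Stdlib Require Import Reals.
Open Scope R_scope.

Definition pt := (R * R)%type.

Definition dot (p q : pt) : R := fst p * fst q + snd p * snd q.

Definition dist (p q : pt) : R :=
  sqrt ((fst p - fst q)^2 + (snd p - snd q)^2).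

Definition convex (K : pt -> Prop) : Prop :=
  forall p q t, K p -> K q -> 0 <= t <= 1 ->
    K ((1 - t) * fst p + t * fst q, (1 - t) * snd p + t * snd q).

Definition bounded (K : pt -> Prop) : Prop :=
  exists M, forall p q, K p -> K q -> dist p q <= M.

Definition closed (K : pt -> Prop) : Prop :=
  forall p, ~ K p -> exists e, 0 < e /\ forall q, dist p q < e -> ~ K q.

Definition nonempty_interior (K : pt -> Prop) : Prop :=
  exists c e, 0 < e /\ forall q, dist c q < e -> K q.

Definition convex_body (K : pt -> Prop) : Prop :=
  convex K /\ closed K /\ bounded K /\ nonempty_interior K.

Definition is_glb (E : R -> Prop) (m : R) : Prop :=
  (forall x, E x -> m <= x) /\ (forall b, (forall x, E x -> b <= x) -> b <= m).

Definition is_diameter (K : pt -> Prop) (D : R) : Prop :=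
  is_lub (fun d => exists p q, K p /\ K q /\ d = dist p q) D.

Definition supporting_line (K : pt -> Prop) (u : pt) (c : R) : Prop :=
  dot u u = 1 /\ (forall x, K x -> dot x u <= c) /\ (exists x, K x /\ dot x u = c).

(* w(K): the smallest distance between two distinct parallel supporting lines.
   Two parallel supporting lines have unit normals u and -u, i.e. are
   {<x,u> = c1} and {<x,u> = c2} with c2 <= <x,u> <= c1 on K; their distance is |c1 - c2|. *)
Definition is_minimal_width (K : pt -> Prop) (w : R) : Prop :=
  is_glb (fun d => exists u c1 c2,
            supporting_line K u c1 /\
            supporting_line K (- fst u, - snd u) (- c2) /\
            c1 <> c2 /\ d = Rabs (c1 - c2)) w.

Definition is_inradius (K : pt -> Prop) (r : R) : Prop :=
  is_lub (fun rho => 0 <= rho /\ exists c, forall q, dist c q <= rho -> K q) r.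

Definition is_circumradius (K : pt -> Prop) (Rc : R) : Prop :=
  is_glb (fun rho => 0 <= rho /\ exists c, forall q, K q -> dist c q <= rho) Rc.

(* Main.v *)
(* Write s = w - r and C = sqrt (1 - (D / (2 R))^2). As 2 R / D = 1 / sqrt (1 - C^2), the
   claim is s <= r sqrt (2 / (1 - C)), i.e. (1 - C) s^2 <= 2 r^2, trivial for s^2 <= 2 r^2.
   Let B be an inball with center 0. By optimality 0 is in the convex hull of the outer normals
   of supporting lines of K touching B; if two of them are opposite then w <= 2 r. Otherwise
   there are three such normals u_i, and K has points X_i with <u_i, X_i> <= - s. The contact
   points of B separate the corners of the triangle {<u_i, x> <= r}, so for each point P of K
   at most one of the segments X_i P misses B. Let P Q be a diameter of K. Some X = X_i has
   both X P and X Q meeting B, and |X| >= s, so the angle t = P X Q satisfies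
   sin (t / 2) <= r / s, i.e. cos t >= 1 - 2 r^2 / s^2 >= 0. Since P Q is the longest side, the
   triangle P Q X is acute, so R is at least its circumradius D / (2 sin t), which says
   C >= cos t. *)

Require Import Defs.
From Stdlib Require Import Reals.
From Stdlib Require Import Lra Lia Psatz Classical ClassicalEpsilon.
(* Reals has its own [dist] and [bounded]; this makes those of Defs visible again. *)
Import Defs.
Open Scope R_scope.

(** * Vectors, distances and Lipschitz bounds in the plane *)

Definition vsub (p q : pt) : pt := (fst p - fst q, snd p - snd q).

Definition cross (p q : pt) : R := fst p * snd q - snd p * fst q.

Ltac coords := unfold cross, vsub, dot in *; simpl in *.

Lemma dot_vsub (u p q : pt) : dot u (vsub p q) = dot u p - dot u q.
Proof. coords; ring. Qed.

Lemma dot_comm (p q : pt) : dot p q = dot q p.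
Proof. coords; ring. Qed.

Lemma dot_self_nonneg (p : pt) : 0 <= dot p p.
Proof. unfold dot; apply Rplus_le_le_0_compat; apply Rle_0_sqr. Qed.

Lemma Rabs_le_inv (x a : R) : Rabs x <= a -> - a <= x <= a.
Proof. unfold Rabs; destruct (Rcase_abs x); lra. Qed.

Lemma dist_euc_eq (p q : pt) : dist p q = dist_euc (fst p) (snd p) (fst q) (snd q).
Proof. unfold dist, dist_euc, Rsqr; f_equal; ring. Qed.

Lemma dist_nonneg (p q : pt) : 0 <= dist p q.
Proof. apply sqrt_pos. Qed.

Lemma dist_sqr (p q : pt) : dist p q ^ 2 = dot (vsub p q) (vsub p q).
Proof.
  unfold dist; rewrite pow2_sqrt; [coords; ring | apply Rplus_le_le_0_compat; apply pow2_ge_0].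
Qed.

Lemma dist_comm (p q : pt) : dist p q = dist q p.
Proof. unfold dist; f_equal; ring. Qed.

Lemma dist_triangle (p q z : pt) : dist p q <= dist p z + dist z q.
Proof. rewrite !dist_euc_eq; apply triangle. Qed.

Lemma dist_le_coords (p q : pt) : dist p q <= Rabs (fst p - fst q) + Rabs (snd p - snd q).
Proof.
  unfold dist.
  set (x := fst p - fst q); set (y := snd p - snd q).
  pose proof (Rabs_pos x); pose proof (Rabs_pos y).
  rewrite <- (pow2_abs x), <- (pow2_abs y).
  apply Rle_trans with (sqrt ((Rabs x + Rabs y) ^ 2)).
  - apply sqrt_le_1_alt; nra.
  - rewrite sqrt_pow2; lra.
Qed.

Lemma coords_le_dist (p q : pt) :
  Rabs (fst p - fst q) <= dist p q /\ Rabs (snd p - snd q) <= dist p q.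
Proof.
  pose proof (dist_nonneg p q) as H0; pose proof (dist_sqr p q) as H1; coords.
  pose proof (Rle_0_sqr (fst p - fst q)); pose proof (Rle_0_sqr (snd p - snd q)).
  unfold Rsqr in *.
  split; apply Rsqr_incr_0_var; auto; rewrite <- Rsqr_abs; unfold Rsqr; nra.
Qed.

Lemma dot_le_norm (u v : pt) (a : R) : dot u u = 1 -> 0 <= a -> dot v v <= a ^ 2 -> dot u v <= a.
Proof.
  intros Hu Ha Hv.
  assert (dot u v ^ 2 + cross u v ^ 2 = dot u u * dot v v) by (coords; ring).
  rewrite Hu in H. nra.
Qed.

Lemma dot_lipschitz (v p q : pt) :
  Rabs (dot p v - dot q v) <= (Rabs (fst v) + Rabs (snd v)) * dist p q.
Proof.
  destruct (coords_le_dist p q) as [H1 H2].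
  replace (dot p v - dot q v) with ((fst p - fst q) * fst v + (snd p - snd q) * snd v)
    by (unfold dot; ring).
  eapply Rle_trans; [apply Rabs_triang|]. rewrite !Rabs_mult.
  pose proof (Rabs_pos (fst v)); pose proof (Rabs_pos (snd v)). nra.
Qed.

(** The factor 1 fits the Lipschitz hypotheses of [min_attained] and [closed_le]. *)
Lemma dist_lipschitz (z p q : pt) : Rabs (dist z p - dist z q) <= 1 * dist p q.
Proof.
  pose proof (dist_triangle z p q); pose proof (dist_triangle z q p).
  rewrite (dist_comm q p) in *. apply Rabs_le; lra.
Qed.

Lemma direction_exists (v : pt) :
  v <> (0, 0) -> exists u a, 0 < a /\ dot u u = 1 /\ v = (a * fst u, a * snd u).
Proof.
  intros Hv. destruct v as [x y].
  assert (Hp : 0 < x ^ 2 + y ^ 2).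
  { destruct (Req_dec x 0) as [->|]; [destruct (Req_dec y 0) as [->|]|]; [congruence|nra|nra]. }
  set (a := sqrt (x ^ 2 + y ^ 2)).
  assert (Ha : 0 < a) by (apply sqrt_lt_R0; auto).
  assert (Ha2 : a * a = x ^ 2 + y ^ 2) by (apply sqrt_sqrt; lra).
  exists (x / a, y / a), a; unfold dot; cbn [fst snd]; repeat split; auto.
  - replace (x / a * (x / a) + y / a * (y / a)) with ((x ^ 2 + y ^ 2) / (a * a)) by (field; lra).
    rewrite <- Ha2; field; lra.
  - f_equal; field; lra.
Qed.

(** * Sequential compactness in the plane *)

Definition tol (n : nat) : R := / INR (S n).

Lemma tol_pos (n : nat) : 0 < tol n.
Proof. apply Rinv_0_lt_compat, lt_0_INR; lia. Qed.

Lemma tol_antitone (m n : nat) : (m <= n)%nat -> tol n <= tol m.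
Proof.
  intros; apply Rinv_le_contravar; [apply lt_0_INR; lia | apply le_INR; lia].
Qed.

Lemma tol_small (e : R) : 0 < e -> exists n, tol n < e.
Proof.
  intros He; destruct (archimed_cor1 e He) as [[|n] [H1 H2]]; [lia|]. exists n; exact H1.
Qed.

Lemma le_of_tol (a b L : R) : 0 <= L -> (forall n, a <= b + L * tol n) -> a <= b.
Proof.
  intros HL H; apply Rnot_lt_le; intros Hab.
  destruct (tol_small ((a - b) / (L + 1))) as [n Hn].
  { apply Rdiv_lt_0_compat; lra. }
  specialize (H n); pose proof (tol_pos n).
  apply (Rmult_lt_compat_l (L + 1)) in Hn; [|lra].
  replace ((L + 1) * ((a - b) / (L + 1))) with (a - b) in Hn by (field; lra). nra.
Qed.

(** The index map need not increase: with [n <= f n], [tol_antitone] already turns errors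
    [tol (f n)] into [tol n]. *)
Lemma real_subsequence (x : nat -> R) (M : R) :
  (forall n, Rabs (x n) <= M) ->
  exists l (f : nat -> nat), forall n, (n <= f n)%nat /\ Rabs (x (f n) - l) < tol n.
Proof.
  intros HM.
  destruct (Bolzano_Weierstrass x (fun c => - M <= c <= M) (compact_P3 _ _)) as [l Hl].
  { intros n. specialize (HM n). apply Rabs_le_inv in HM; lra. }
  assert (H : forall n, exists k, (n <= k)%nat /\ Rabs (x k - l) < tol n).
  { intros n. apply (Hl (disc l (mkposreal _ (tol_pos n))) n).
    exists (mkposreal _ (tol_pos n)); intros z Hz; exact Hz. }
  exists l, (fun n => proj1_sig (constructive_indefinite_description _ (H n))).
  intros n; exact (proj2_sig (constructive_indefinite_description _ (H n))).
Qed.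

Lemma convergent_subsequence (K : pt -> Prop) (u : nat -> pt) :
  closed K -> bounded K -> (forall n, K (u n)) ->
  exists l (f : nat -> nat), K l /\ forall n, (n <= f n)%nat /\ dist (u (f n)) l <= 2 * tol n.
Proof.
  intros HC [M HM] Hu.
  destruct (real_subsequence (fun n => fst (u n)) (M + Rabs (fst (u O)))) as (x & f & Hf).
  { intros n. destruct (coords_le_dist (u n) (u O)) as [H _].
    pose proof (HM _ _ (Hu n) (Hu O)).
    pose proof (Rabs_triang (fst (u n) - fst (u O)) (fst (u O))) as H1.
    replace (fst (u n) - fst (u O) + fst (u O)) with (fst (u n)) in H1 by ring. lra. }
  destruct (real_subsequence (fun n => snd (u (f n))) (M + Rabs (snd (u O)))) as (y & g & Hg).
  { intros n. destruct (coords_le_dist (u (f n)) (u O)) as [_ H].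
    pose proof (HM _ _ (Hu (f n)) (Hu O)).
    pose proof (Rabs_triang (snd (u (f n)) - snd (u O)) (snd (u O))) as H1.
    replace (snd (u (f n)) - snd (u O) + snd (u O)) with (snd (u (f n))) in H1 by ring. lra. }
  assert (Hd : forall n, (n <= f (g n))%nat /\ dist (u (f (g n))) (x, y) <= 2 * tol n).
  { intros n. destruct (Hg n) as [Hg1 Hg2], (Hf (g n)) as [Hf1 Hf2]. split; [lia|].
    eapply Rle_trans; [apply dist_le_coords|]. simpl.
    pose proof (tol_antitone _ _ Hg1). lra. }
  exists (x, y), (fun n => f (g n)). split; auto.
  apply NNPP; intros HK. destruct (HC _ HK) as (e & He & Hfar).
  destruct (tol_small (e / 2)) as [n Hn]; [lra|].
  apply (Hfar (u (f (g n)))); auto. rewrite dist_comm. destruct (Hd n). lra.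
Qed.

Lemma min_attained (K : pt -> Prop) (f : pt -> R) (L : R) :
  closed K -> bounded K -> (exists p, K p) ->
  0 <= L -> (forall p q, Rabs (f p - f q) <= L * dist p q) ->
  exists p, K p /\ forall q, K q -> f p <= f q.
Proof.
  intros HC HB [p0 Hp0] HL Hf.
  destruct (completeness (fun x => exists p, K p /\ x = - f p)) as [m [Hm1 Hm2]].
  { destruct HB as [M HM]. exists (- f p0 + L * M). intros x (p & Hp & ->).
    pose proof (HM _ _ Hp Hp0). pose proof (Rabs_le_inv _ _ (Hf p p0)). nra. }
  { exists (- f p0), p0; auto. }
  assert (H : forall n, exists p, K p /\ f p < - m + tol n).
  { intros n. apply NNPP; intros Hn. pose proof (tol_pos n).
    assert (m <= m - tol n); [|lra]. apply Hm2. intros x (p & Hp & ->).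
    apply Rnot_lt_le; intros Hlt. apply Hn; exists p; split; auto; lra. }
  set (u n := proj1_sig (constructive_indefinite_description _ (H n))).
  assert (Hu : forall n, K (u n) /\ f (u n) < - m + tol n)
    by (intros n; exact (proj2_sig (constructive_indefinite_description _ (H n)))).
  destruct (convergent_subsequence K u) as (l & g & Hl & Hg); auto; [apply Hu|].
  exists l; split; auto. intros q Hq.
  assert (- f q <= m) by (apply Hm1; exists q; auto).
  enough (f l <= - m) by lra.
  (* The minimizing sequence contributes 1, the Lipschitz bound at distance [2 * tol n] contributes
     [2 * L]. *)
  apply le_of_tol with (1 + 2 * L); [lra|]. intros n.
  destruct (Hg n) as [Hg1 Hg2], (Hu (g n)) as [_ Hv].
  pose proof (tol_antitone _ _ Hg1). pose proof (Rabs_le_inv _ _ (Hf (u (g n)) l)). nra.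
Qed.

Lemma diameter_attained (K : pt -> Prop) (D : R) :
  closed K -> bounded K -> is_diameter K D ->
  exists P Q, K P /\ K Q /\ dist P Q = D.
Proof.
  intros HC HB [HD1 HD2].
  assert (H : forall n, exists z : pt * pt, K (fst z) /\ K (snd z) /\ D - tol n < dist (fst z) (snd z)).
  { intros n. apply NNPP; intros Hn. pose proof (tol_pos n).
    assert (D <= D - tol n); [|lra]. apply HD2. intros x (p & q & Hp & Hq & ->).
    apply Rnot_lt_le; intros Hlt. apply Hn; exists (p, q); auto. }
  set (u n := proj1_sig (constructive_indefinite_description _ (H n))).
  assert (Hu : forall n, K (fst (u n)) /\ K (snd (u n)) /\ D - tol n < dist (fst (u n)) (snd (u n)))
    by (intros n; exact (proj2_sig (constructive_indefinite_description _ (H n)))).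
  destruct (convergent_subsequence K (fun n => fst (u n))) as (P & f & HP & Hf); auto; [apply Hu|].
  destruct (convergent_subsequence K (fun n => snd (u (f n)))) as (Q & g & HQ & Hg); auto; [intros; apply Hu|].
  exists P, Q; repeat split; auto. apply Rle_antisym.
  - apply HD1; exists P, Q; auto.
  (* One unit comes from the nearly maximal pair and two from each of the two extractions. *)
  - apply le_of_tol with 5; [lra|]. intros n.
    destruct (Hg n) as [Hg1 Hg2], (Hf (g n)) as [Hf1 Hf2], (Hu (f (g n))) as (_ & _ & Hv).
    pose proof (tol_antitone _ _ Hg1). pose proof (tol_antitone _ _ Hf1).
    pose proof (dist_triangle (fst (u (f (g n)))) (snd (u (f (g n)))) P).
    pose proof (dist_triangle P (snd (u (f (g n)))) Q).
    rewrite (dist_comm Q) in *. lra.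
Qed.

Lemma inball_attained (K : pt -> Prop) (r : R) :
  closed K -> bounded K -> 0 < r -> is_inradius K r ->
  exists c, forall q, dist c q <= r -> K q.
Proof.
  intros HC HB Hr [_ Hr2].
  assert (H : forall n, exists c, forall q, dist c q <= r - tol n -> K q).
  { intros n. apply NNPP; intros Hn. pose proof (tol_pos n).
    assert (r <= r - tol n); [|lra]. apply Hr2. intros x [Hx [c Hc]].
    apply Rnot_lt_le; intros Hlt. apply Hn; exists c; intros; apply Hc; lra. }
  (* From [N] on the radii [r - tol (N + n)] are positive, so the centers lie in [K]. *)
  destruct (tol_small r Hr) as [N HN].
  set (u n := proj1_sig (constructive_indefinite_description _ (H (N + n)%nat))).
  assert (Hu : forall n q, dist (u n) q <= r - tol (N + n) -> K q)
    by (intros n; exact (proj2_sig (constructive_indefinite_description _ (H (N + n)%nat)))).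
  destruct (convergent_subsequence K u) as (c & f & Hc & Hf); auto.
  { intros n. apply (Hu n). replace (dist (u n) (u n)) with 0.
    - pose proof (tol_antitone N (N + n) ltac:(lia)). lra.
    - unfold dist; rewrite !Rminus_diag; replace (0 ^ 2 + 0 ^ 2) with 0 by ring. now rewrite sqrt_0. }
  exists c; intros q Hq. apply NNPP; intros HK. destruct (HC _ HK) as (e & He & Hfar).
  destruct (tol_small (e / 4)) as [n Hn]; [lra|].
  destruct (Hf n) as [Hf1 Hf2].
  set (a := u (f n)) in *. set (d := tol (N + f n)).
  assert (Hd : d <= tol n) by (apply tol_antitone; lia).
  assert (Hd0 : 0 < d) by apply tol_pos.
  assert (HdN : d <= tol N) by (apply tol_antitone; lia).
  assert (Haq : dist a q <= r + 2 * tol n) by (pose proof (dist_triangle a q c); lra).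
  (* The point [z] below is [q] pulled towards [a] far enough to enter the ball of radius [r - d];
     it moves by at most [2 * tol n + d <= 3 * tol n < e]. *)
  set (t := (r - d) / (r + 2 * tol n)).
  assert (Ht : t * (r + 2 * tol n) = r - d) by (unfold t; field; lra).
  assert (Ht0 : 0 <= t) by (apply Rmult_le_pos; [lra|left; apply Rinv_0_lt_compat; lra]).
  assert (Ht1 : t <= 1) by nra.
  set (z := (fst a + t * (fst q - fst a), snd a + t * (snd q - snd a)) : pt).
  assert (E : forall s p p', 0 <= s ->
    (fst p - fst p') ^ 2 + (snd p - snd p') ^ 2 = s ^ 2 * ((fst a - fst q) ^ 2 + (snd a - snd q) ^ 2) ->
    dist p p' = s * dist a q).
  { intros s p p' Hs Hpp. unfold dist. rewrite Hpp, sqrt_mult_alt, sqrt_pow2; auto. nra. }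
  assert (E1 : dist a z = t * dist a q) by (apply E; auto; simpl; ring).
  assert (E2 : dist q z = (1 - t) * dist a q) by (apply E; [lra|simpl; ring]).
  apply (Hfar z).
  - rewrite E2. nra.
  - apply (Hu (f n)). fold a. rewrite E1. fold d. nra.
Qed.

(** * Contact directions of the inball *)

Lemma closed_le (f : pt -> R) (a L : R) :
  0 <= L -> (forall p q, Rabs (f p - f q) <= L * dist p q) -> closed (fun p => f p <= a).
Proof.
  intros HL Hf p Hp. exists ((f p - a) / (L + 1)). split.
  - apply Rdiv_lt_0_compat; lra.
  - intros q Hq Hqa. pose proof (Rabs_le_inv _ _ (Hf p q)). pose proof (dist_nonneg p q).
    apply (Rmult_lt_compat_l (L + 1)) in Hq; [|lra].
    replace ((L + 1) * ((f p - a) / (L + 1))) with (f p - a) in Hq by (field; lra). nra.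
Qed.

Lemma closed_forall (I : Type) (A : I -> pt -> Prop) :
  (forall i, closed (A i)) -> closed (fun p => forall i, A i p).
Proof.
  intros HA p Hp. apply not_all_ex_not in Hp as [i Hi].
  destruct (HA i p Hi) as (e & He & H). exists e; split; auto.
  intros q Hq Hall; exact (H q Hq (Hall i)).
Qed.

Lemma closed_and (A B : pt -> Prop) : closed A -> closed B -> closed (fun p => A p /\ B p).
Proof.
  intros HA HB p Hp. apply not_and_or in Hp as [Hp|Hp].
  - destruct (HA p Hp) as (e & He & H). exists e; split; auto. intros q Hq []; exact (H q Hq H0).
  - destruct (HB p Hp) as (e & He & H). exists e; split; auto. intros q Hq []; exact (H q Hq H1).
Qed.

Lemma closed_ext (A B : pt -> Prop) : (forall p, A p <-> B p) -> closed A -> closed B.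
Proof.
  intros HAB HA p Hp. destruct (HA p) as (e & He & H); [rewrite HAB; auto|].
  exists e; split; auto. intros q Hq; rewrite <- HAB; auto.
Qed.

Lemma dot_lipschitz_const (v : pt) : 0 <= Rabs (fst v) + Rabs (snd v).
Proof. pose proof (Rabs_pos (fst v)); pose proof (Rabs_pos (snd v)); lra. Qed.

Lemma closed_dot_le (v : pt) (a : R) : closed (fun p => dot p v <= a).
Proof.
  exact (closed_le (fun p => dot p v) a _ (dot_lipschitz_const v) (dot_lipschitz v)).
Qed.

Lemma dist_origin_unit (u : pt) : dist (0, 0) u = 1 <-> dot u u = 1.
Proof.
  pose proof (dist_nonneg (0, 0) u). pose proof (dist_sqr (0, 0) u) as E.
  replace (dot (vsub (0, 0) u) (vsub (0, 0) u)) with (dot u u) in E by (coords; ring).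
  split; intros; nra.
Qed.

(** The distance from the origin is Lipschitz on the plane, while the quadratic [dot u u] is not. *)
Lemma closed_unit_circle : closed (fun u => dot u u = 1).
Proof.
  apply closed_ext with (fun u => dist (0, 0) u <= 1 /\ - dist (0, 0) u <= - 1).
  { intros u. rewrite <- dist_origin_unit. lra. }
  apply closed_and; apply closed_le with 1; try lra.
  - apply dist_lipschitz.
  - intros p q. pose proof (dist_lipschitz (0, 0) p q) as H.
    rewrite <- Rabs_Ropp. now replace (- (- dist (0, 0) p - - dist (0, 0) q))
      with (dist (0, 0) p - dist (0, 0) q) by ring.
Qed.

Lemma bounded_unit_circle : bounded (fun u => dot u u = 1).
Proof.
  exists 2. intros p q Hp Hq. apply dist_origin_unit in Hp, Hq.
  pose proof (dist_triangle p q (0, 0)) as H. rewrite (dist_comm p (0, 0)) in H. lra.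
Qed.

(** Let [z] be a point of [K] nearest to [y]; the direction of [y - z] separates. *)
Lemma separating_direction (K : pt -> Prop) (y : pt) :
  convex K -> closed K -> bounded K -> (exists p, K p) -> ~ K y ->
  exists u, dot u u = 1 /\ forall x, K x -> dot u x <= dot u y.
Proof.
  intros HV HC HB HN Hy.
  destruct (min_attained K (dist y) 1) as (z & Hz & Hmin); auto; [lra|apply dist_lipschitz|].
  destruct (direction_exists (vsub y z)) as (u & a & Ha & Hu & Ez).
  { intros E. apply Hy. replace y with z; auto. destruct y, z; unfold vsub in E; simpl in E.
    inversion E; f_equal; lra. }
  exists u; split; auto. intros x Hx.
  assert (Hxz : dot (vsub x z) (vsub y z) <= 0).
  { set (B := dot (vsub x z) (vsub y z)). set (A := dot (vsub x z) (vsub x z)).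
    apply Rnot_lt_le; intros HBpos.
    (* Moving from [z] towards [x] cannot come closer to [y]; the step [B / A], or 1 when [A <= B],
       refutes [0 < B]. *)
    assert (Hvar : forall t, 0 <= t <= 1 -> 0 <= t * (t * A - 2 * B)).
    { intros t Ht. pose proof (Hmin _ (HV z x t Hz Hx Ht)) as H.
      assert (H' := pow_incr _ _ 2 (conj (dist_nonneg y z) H)); clear H; rename H' into H.
      rewrite !dist_sqr in H.
      apply Rle_minus in H.
      match type of H with ?e <= 0 => replace (t * (t * A - 2 * B)) with (- e); [lra|] end.
      unfold A, B; coords; ring. }
    assert (0 <= A) by (apply dot_self_nonneg).
    destruct (Rle_dec A B).
    - specialize (Hvar 1); lra.
    - assert (Ht : 0 < B / A) by (apply Rdiv_lt_0_compat; lra).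
      assert (Et : B / A * A = B) by (field; lra).
      specialize (Hvar (B / A)). nra. }
  assert (0 <= a * (dot u y - dot u z)) by
    (rewrite <- dot_vsub; rewrite Ez; replace (a * dot u (a * fst u, a * snd u)) with (a * a * dot u u)
     by (coords; ring); rewrite Hu; nra).
  assert (a * (dot u x - dot u z) <= 0) by
    (rewrite <- dot_vsub; rewrite Ez in Hxz;
     replace (a * dot u (vsub x z)) with (dot (vsub x z) (a * fst u, a * snd u)) by (coords; ring); lra).
  nra.
Qed.

(** For a ball contained in [K] these are the outer unit normals of the supporting lines of [K] that
    touch the ball. *)
Definition contact (K : pt -> Prop) (c : pt) (r : R) (u : pt) : Prop :=
  dot u u = 1 /\ forall x, K x -> dot u (vsub x c) <= r.

Lemma closed_contact_halfplane (K : pt -> Prop) (c : pt) (r : R) (v : pt) :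
  closed (fun u => contact K c r u /\ dot u v <= 0).
Proof.
  apply closed_and; [apply closed_and|].
  - apply closed_unit_circle.
  - apply closed_forall; intros x. intros u Hu.
    apply imply_to_and in Hu as [HK Hu].
    destruct (closed_dot_le (vsub x c) r u Hu) as (e & He & H).
    exists e; split; auto. intros q Hq Hq'; exact (H q Hq (Hq' HK)).
  - apply closed_dot_le.
Qed.

Lemma ball_boundary_point (K : pt -> Prop) (c u : pt) (r : R) :
  0 <= r -> (forall q, dist c q <= r -> K q) -> dot u u = 1 ->
  K (fst c + r * fst u, snd c + r * snd u).
Proof.
  intros Hr Hball Hu. apply Hball. unfold dist; cbn [fst snd].
  replace ((fst c - (fst c + r * fst u)) ^ 2 + (snd c - (snd c + r * snd u)) ^ 2)
    with (r ^ 2 * dot u u) by (unfold dot; ring).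
  rewrite Hu, Rmult_1_r, sqrt_pow2; lra.
Qed.

(* Otherwise the ball could be moved along [- v] and enlarged; the enlargement
   [tol n ^ 2] is of lower order than the displacement [tol n]. *)
Lemma contact_in_halfplane (K : pt -> Prop) (c v : pt) (r : R) :
  convex K -> closed K -> bounded K -> 0 < r -> is_inradius K r ->
  (forall q, dist c q <= r -> K q) ->
  exists u, contact K c r u /\ dot u v <= 0.
Proof.
  intros HV HC HB Hr [Hr1 _] Hball.
  set (N := Rabs (fst v) + Rabs (snd v)).
  assert (HN : 0 <= N) by apply dot_lipschitz_const.
  assert (H : forall n, exists u, dot u u = 1 /\ dot u v <= tol n /\
                forall x, K x -> dot u (vsub x c) <= r + (N + 1) * tol n).
  { intros n. pose proof (tol_pos n) as Ht.
    assert (Ht1 : tol n <= 1) by (pose proof (tol_antitone 0 n ltac:(lia)) as H; unfold tol in H at 2;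
      simpl in H; lra).
    set (t := tol n) in *.
    set (c' := (fst c - t * fst v, snd c - t * snd v) : pt).
    (* By maximality of [r] the moved and enlarged ball leaves [K]; a point [y] of it outside [K] is
       then separated from [K]. *)
    assert (exists y, dist c' y <= r + t ^ 2 /\ ~ K y) as (y & Hy & HyK).
    { apply NNPP; intros Hn. assert (r + t ^ 2 <= r); [|nra].
      apply Hr1. split; [nra|]. exists c'. intros q Hq. apply NNPP; intros HK. apply Hn; exists q; auto. }
    destruct (separating_direction K y) as (u & Hu & Hsep); auto.
    { exists (fst c + r * 1, snd c + r * 0). apply (ball_boundary_point K c (1, 0)); auto; [lra|].
      unfold dot; simpl; ring. }
    assert (H1 : dot u (vsub y c') <= r + t ^ 2).
    { apply dot_le_norm; auto; [nra|]. rewrite <- dist_sqr, dist_comm. apply pow_incr.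
      pose proof (dist_nonneg c' y); lra. }
    assert (H2 : dot u (vsub y c') = dot u (vsub y c) + t * dot u v) by (unfold c'; coords; ring).
    assert (H3 : dot u c + r <= dot u y).
    { replace (dot u c + r) with (dot u (fst c + r * fst u, snd c + r * snd u)).
      - apply Hsep, ball_boundary_point; auto; lra.
      - replace (dot u (fst c + r * fst u, snd c + r * snd u)) with (dot u c + r * dot u u) by (coords; ring).
        rewrite Hu; ring. }
    assert (H4 : Rabs (dot u v) <= N).
    { pose proof (dot_lipschitz v u (0, 0)) as H. fold N in H.
      rewrite dist_comm, (proj2 (dist_origin_unit u) Hu) in H.
      replace (dot u v - dot (0, 0) v) with (dot u v) in H by (coords; ring). lra. }
    apply Rabs_le_inv in H4.
    rewrite H2, dot_vsub in H1. exists u; repeat split; auto.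
    (* Here [r + t * dot u v <= dot u (vsub y c') <= r + t ^ 2]; divide by [t]. *)
    - apply Rmult_le_reg_l with t; auto; nra.
    - intros x Hx. specialize (Hsep x Hx). rewrite dot_vsub. nra. }
  set (s n := proj1_sig (constructive_indefinite_description _ (H n))).
  assert (Hs : forall n, dot (s n) (s n) = 1 /\ dot (s n) v <= tol n /\
                forall x, K x -> dot (s n) (vsub x c) <= r + (N + 1) * tol n)
    by (intros n; exact (proj2_sig (constructive_indefinite_description _ (H n)))).
  destruct (convergent_subsequence (fun u => dot u u = 1) s) as (u & f & Hu & Hf).
  - apply closed_unit_circle.
  - apply bounded_unit_circle.
  - apply Hs.
  - exists u. split; [split; auto|].
    + intros x Hx. pose proof (dot_lipschitz_const (vsub x c)).
      pose proof (dot_lipschitz (vsub x c)) as HL.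
      set (L := Rabs (fst (vsub x c)) + Rabs (snd (vsub x c))) in *.
      apply le_of_tol with (N + 1 + 2 * L); [lra|]. intros n.
      destruct (Hf n) as [Hf1 Hf2], (Hs (f n)) as (_ & _ & Hv). specialize (Hv x Hx).
      pose proof (Rabs_le_inv _ _ (HL (s (f n)) u)). pose proof (tol_antitone _ _ Hf1). nra.
    + apply le_of_tol with (1 + 2 * N); [lra|]. intros n.
      destruct (Hf n) as [Hf1 Hf2], (Hs (f n)) as (_ & Hv & _).
      pose proof (Rabs_le_inv _ _ (dot_lipschitz v (s (f n)) u)) as HL. fold N in HL.
      pose proof (tol_antitone _ _ Hf1). nra.
Qed.

(** The pairs are points a, b, u of the unit circle. As a is in the upper half, b in the lower half
    and their cross product is negative, the arc from b through (1, 0) to a is shorter than a half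
    circle, and u lies on it between (1, 0) and a. The sum a + b bisects this arc, so it makes an
    acute angle with u. *)
Lemma arc_pos_upper (fa ga fb gb fu gu : R) :
  fa ^ 2 + ga ^ 2 = 1 -> fb ^ 2 + gb ^ 2 = 1 -> fu ^ 2 + gu ^ 2 = 1 ->
  0 <= ga -> gb <= 0 -> fa * gb - ga * fb < 0 -> 0 <= gu -> fa <= fu ->
  0 < fu * (fa + fb) + gu * (ga + gb).
Proof.
  intros Ha Hb Hu Hga Hgb Hab Hgu Hfu.
  assert (Hau : fa * gu - ga * fu <= 0).
  { destruct (Rle_dec 0 fa); [assert (gu <= ga) by nra; nra|].
    destruct (Rle_dec 0 fu); [nra|]. assert (ga <= gu) by nra. nra. }
  assert (Hub : fu * gb - gu * fb <= 0).
  { destruct (Rle_dec 0 fb) as [Hfb|Hfb].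
    - destruct (Rle_dec 0 fu); [nra|]. assert (ga <= gu) by nra. nra.
    - destruct (Rle_dec fa 0); [nra|]. assert (gu <= ga) by nra. nra. }
  assert (Hcos : 0 < 1 + (fa * fb + ga * gb)).
  { assert ((fa * fb + ga * gb) ^ 2 + (fa * gb - ga * fb) ^ 2 = 1)
      by (replace 1 with ((fa ^ 2 + ga ^ 2) * (fb ^ 2 + gb ^ 2)) by (rewrite Ha, Hb; ring); ring).
    nra. }
  assert (Hsum : (fu * gb - gu * fb) + (fa * gu - ga * fu) < 0).
  { apply Rnot_le_lt; intros Hs.
    assert (E1 : fu * gb - gu * fb = 0) by lra. assert (E2 : fa * gu - ga * fu = 0) by lra.
    assert ((fa * gb - ga * fb) * fu = 0)
      by (transitivity ((fu * gb - gu * fb) * fa + (fa * gu - ga * fu) * fb); [ring|rewrite E1, E2; ring]).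
    assert ((fa * gb - ga * fb) * gu = 0)
      by (transitivity ((fu * gb - gu * fb) * ga + (fa * gu - ga * fu) * gb); [ring|rewrite E1, E2; ring]).
    assert (fu = 0) by nra. assert (gu = 0) by nra. subst; lra. }
  (* After normalization the right side is the positive factor of [Hcos] times the negative sum of
     [Hsum]. *)
  assert (E : (fa * gb - ga * fb) * (fu * (fa + fb) + gu * (ga + gb)) =
     ((fu * gb - gu * fb) * ((fa ^ 2 + ga ^ 2) + (fa * fb + ga * gb)) +
      (fa * gu - ga * fu) * ((fb ^ 2 + gb ^ 2) + (fa * fb + ga * gb)))) by ring.
  rewrite Ha, Hb in E. nra.
Qed.

(** For [gu <= 0], reflect in the first axis; this exchanges the roles of a and b. *)
Lemma arc_pos (fa ga fb gb fu gu : R) :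
  fa ^ 2 + ga ^ 2 = 1 -> fb ^ 2 + gb ^ 2 = 1 -> fu ^ 2 + gu ^ 2 = 1 ->
  0 <= ga -> gb <= 0 -> fa * gb - ga * fb < 0 ->
  (0 <= gu -> fa <= fu) -> (gu <= 0 -> fb <= fu) ->
  0 < fu * (fa + fb) + gu * (ga + gb).
Proof.
  intros Ha Hb Hu Hga Hgb Hab Hpos Hneg. destruct (Rle_dec 0 gu).
  - apply arc_pos_upper; auto.
  - replace (fu * (fa + fb) + gu * (ga + gb)) with (fu * (fb + fa) + - gu * (- gb + - ga)) by ring.
    apply arc_pos_upper; try lra; try nra; apply Hneg; lra.
Qed.

(* The origin is in the convex hull of [U]; the alternatives say that it is in a segment
   or in the interior of a triangle with vertices in [U]. *)
Lemma antipodal_or_spanning_triple (U : pt -> Prop) :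
  (forall u, U u -> dot u u = 1) ->
  (forall v, closed (fun u => U u /\ dot u v <= 0)) ->
  (forall v, exists u, U u /\ dot u v <= 0) ->
  (exists a b, U a /\ U b /\ fst a = - fst b /\ snd a = - snd b) \/
  (exists a b c, U a /\ U b /\ U c /\ 0 < cross a b /\ 0 < cross b c /\ 0 < cross c a).
Proof.
  intros Hunit Hclosed Hhalf.
  destruct (classic (exists a b, U a /\ U b /\ fst a = - fst b /\ snd a = - snd b)) as [|Hanti];
    [left; auto | right].
  destruct (Hhalf (0, 0)) as (u0 & Hu0 & _).
  pose proof (Hunit u0 Hu0) as E0.
  (* On [U] these are the cosine and sine of the angle from [u0]. *)
  set (f u := dot u u0). set (g u := cross u0 u).
  assert (Hfg : forall u, U u -> f u ^ 2 + g u ^ 2 = 1).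
  { intros u Hu. transitivity (dot u u * dot u0 u0).
    - unfold f, g; coords; ring.
    - rewrite E0, (Hunit u Hu); ring. }
  assert (Hdot : forall u v, dot u v = f u * f v + g u * g v).
  { intros u v. transitivity (dot u v * dot u0 u0); [rewrite E0; ring|]. unfold f, g; coords; ring. }
  assert (Hcross : forall u v, cross u v = f u * g v - g u * f v).
  { intros u v. transitivity (cross u v * dot u0 u0); [rewrite E0; ring|]. unfold f, g; coords; ring. }
  assert (Hopp : forall u v, U u -> U v -> f u = - f v -> g u = - g v -> False).
  { intros u v Hu Hv Hf Hg. apply Hanti; exists u, v. repeat split; auto.
    - transitivity (f u * fst u0 - g u * snd u0).
      + transitivity (fst u * dot u0 u0); [rewrite E0; ring|]. unfold f, g; coords; ring.
      + rewrite Hf, Hg. transitivity (- (fst v * dot u0 u0)); [|rewrite E0; ring].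
        unfold f, g; coords; ring.
    - transitivity (f u * snd u0 + g u * fst u0).
      + transitivity (snd u * dot u0 u0); [rewrite E0; ring|]. unfold f, g; coords; ring.
      + rewrite Hf, Hg. transitivity (- (snd v * dot u0 u0)); [|rewrite E0; ring].
        unfold f, g; coords; ring. }
  assert (f0 : f u0 = 1) by exact E0.
  assert (g0 : g u0 = 0) by (unfold g; coords; ring).
  set (v := (- snd u0, fst u0) : pt). set (v' := (snd u0, - fst u0) : pt).
  assert (Hv : forall u, dot u v = g u) by (intros; unfold g, v; coords; ring).
  assert (Hv' : forall u, dot u v' = - g u) by (intros; unfold g, v'; coords; ring).
  assert (Hext : forall x, dot u0 x <= 0 -> exists a, (U a /\ dot a x <= 0) /\
            forall u, U u /\ dot u x <= 0 -> f a <= f u).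
  { intros x Hx. apply min_attained with (Rabs (fst u0) + Rabs (snd u0)).
    - apply Hclosed.
    - destruct bounded_unit_circle as [M HM]. exists M. intros p q [Hp _] [Hq _]; apply HM; auto.
    - exists u0; auto.
    - apply dot_lipschitz_const.
    - apply dot_lipschitz. }
  (* In the upper and lower half circle respectively, [a] and [b] are the elements of [U] farthest
     in angle from [u0]. *)
  destruct (Hext v') as (a & [Ha Hga] & Hamin); [rewrite Hv', g0; lra|].
  destruct (Hext v) as (b & [Hb Hgb] & Hbmin); [rewrite Hv, g0; lra|].
  rewrite Hv' in Hga. rewrite Hv in Hgb.
  assert (Hau : forall u, U u -> 0 <= g u -> f a <= f u)
    by (intros u Hu Hg; apply Hamin; rewrite Hv'; split; auto; lra).
  assert (Hbu : forall u, U u -> g u <= 0 -> f b <= f u)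
    by (intros u Hu Hg; apply Hbmin; rewrite Hv; split; auto; lra).
  pose proof (Hfg a Ha) as Ea. pose proof (Hfg b Hb) as Eb.
  (* If [cross a b < 0], then [arc_pos] puts all of [U] in the open half-plane of direction [a + b],
     which [Hhalf] forbids. *)
  assert (Hab : 0 <= cross a b).
  { rewrite Hcross. apply Rnot_lt_le; intros Hlt.
    destruct (Hhalf (fst a + fst b, snd a + snd b)) as (u & Hu & Hle).
    replace (dot u (fst a + fst b, snd a + snd b)) with (dot u a + dot u b) in Hle by (coords; ring).
    rewrite !Hdot in Hle.
    pose proof (arc_pos (f a) (g a) (f b) (g b) (f u) (g u)) as Hpos.
    enough (0 < f u * (f a + f b) + g u * (g a + g b)) by lra.
    apply Hpos; auto; lra. }
  rewrite Hcross in Hab.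
  assert (Hnot1 : ~ (f a = 1 /\ f b = 1)).
  { intros [H1 H2]. destruct (Hhalf u0) as (u & Hu & Hle). fold (f u) in Hle.
    destruct (Rle_dec 0 (g u)).
    - specialize (Hau u Hu); lra.
    - specialize (Hbu u Hu); lra. }
  (* On the axis of [u0] the only other unit vector is [- u0], which would be antipodal. *)
  assert (Hpm : forall u, U u -> g u = 0 -> f u = 1).
  { intros u Hu Hg. pose proof (Hfg u Hu) as E. rewrite Hg in E.
    assert ((f u - 1) * (f u + 1) = 0) as H by lra.
    apply Rmult_integral in H as [H|H]; [lra|]. exfalso; apply (Hopp u u0); auto; lra. }
  assert (Hga' : 0 < g a).
  { destruct (Req_dec (g a) 0) as [H|]; [|lra]. exfalso. pose proof (Hpm a Ha H) as H1.
    rewrite H, H1 in Hab. apply Hnot1; split; auto. apply Hpm; auto; lra. }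
  assert (Hgb' : g b < 0).
  { destruct (Req_dec (g b) 0) as [H|]; [|lra]. exfalso. pose proof (Hpm b Hb H) as H1.
    rewrite H, H1 in Hab. lra. }
  exists u0, a, b. repeat split; auto.
  (* Parallel [a] and [b] on different sides of the axis of [u0] would be antipodal. *)
  - rewrite Hcross. destruct (Req_dec (f a * g b - g a * f b) 0) as [H|]; [|lra].
    exfalso.
    assert (Hdet : (f a * f b + g a * g b) ^ 2 = 1).
    { replace 1 with ((f a ^ 2 + g a ^ 2) * (f b ^ 2 + g b ^ 2)) by (rewrite Ea, Eb; ring).
      transitivity ((f a * f b + g a * g b) ^ 2 + (f a * g b - g a * f b) ^ 2); [rewrite H; ring|ring]. }
    assert (H1 : f a * (f a * f b + g a * g b) = f b).
    { transitivity (f b * (f a ^ 2 + g a ^ 2) + g a * (f a * g b - g a * f b)); [ring|].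
      rewrite H, Ea; ring. }
    assert (H2 : g a * (f a * f b + g a * g b) = g b).
    { transitivity (g b * (f a ^ 2 + g a ^ 2) - f a * (f a * g b - g a * f b)); [ring|].
      rewrite H, Ea; ring. }
    assert (f a * f b + g a * g b = - 1) as H3 by nra.
    rewrite H3 in H1, H2. apply (Hopp a b); auto; lra.
  - rewrite Hcross, f0, g0. lra.
Qed.

(** * Segments meeting the inball *)

(* The ray from [X] through [P] meets the disk of radius [r] about the origin. *)
Definition aims (r : R) (X P : pt) : Prop :=
  dot (vsub P X) X < 0 /\ cross (vsub P X) X ^ 2 <= r ^ 2 * dot (vsub P X) (vsub P X).

(** A tangent of the disk cuts off both points. If [P - X] has no component towards the origin, its
    normal is the direction of [X]; otherwise the line through [X] and [P] misses the disk, and its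
    own normal, pointing away from the origin, serves. *)
Lemma common_cap (r : R) (X P : pt) :
  0 < r -> r ^ 2 < dot X X -> ~ aims r X P ->
  exists n, dot n n = 1 /\ r < dot n X /\ r < dot n P.
Proof.
  intros Hr HX Hn. apply not_and_or in Hn as [Hn|Hn].
  - destruct (direction_exists X) as (n & a & Ha & En & EX).
    { intros ->. coords; nra. }
    assert (HXX : dot X X = a ^ 2 * dot n n) by (rewrite EX; coords; ring).
    assert (HnX : dot n X = a * dot n n) by (rewrite EX; coords; ring).
    assert (HPX : dot (vsub P X) X = a * (dot n P - dot n X))
      by (rewrite <- dot_vsub; rewrite EX at 2; coords; ring).
    rewrite En in *. assert (r < a) by nra.
    exists n; repeat split; auto; [lra|]. assert (0 <= dot n P - dot n X) by nra. lra.
  - apply Rnot_le_lt in Hn. set (d := vsub P X) in *.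
    destruct (direction_exists d) as (m & a & Ha & Em & Ed).
    { intros E. rewrite E in Hn. coords; nra. }
    assert (Ec : cross d X = a * cross m X) by (rewrite Ed; coords; ring).
    assert (Edd : dot d d = a ^ 2 * dot m m) by (rewrite Ed; coords; ring).
    rewrite Ec, Edd, Em in Hn.
    assert (Hc : r ^ 2 < cross m X ^ 2) by nra.
    assert (EP : cross m P = cross m X).
    { assert (cross m d = 0) by (rewrite Ed; coords; ring).
      assert (cross m d = cross m P - cross m X) by (unfold d; coords; ring). lra. }
    destruct (Rle_dec 0 (cross m X)).
    + exists (- snd m, fst m). repeat split.
      * rewrite <- Em; coords; ring.
      * replace (dot (- snd m, fst m) X) with (cross m X) by (coords; ring). nra.
      * replace (dot (- snd m, fst m) P) with (cross m P) by (coords; ring). nra.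
    + exists (snd m, - fst m). repeat split.
      * rewrite <- Em; coords; ring.
      * replace (dot (snd m, - fst m) X) with (- cross m X) by (coords; ring). nra.
      * replace (dot (snd m, - fst m) P) with (- cross m P) by (coords; ring). nra.
Qed.

(** Coefficients come from Cramer's rule; a sign change among the cross products with [n] tells
    which cone contains it. *)
Lemma cone_decomposition (a b c n : pt) :
  0 < cross a b -> 0 < cross b c -> 0 < cross c a ->
  exists s t, 0 <= s /\ 0 <= t /\
    (n = (s * fst a + t * fst b, s * snd a + t * snd b) \/
     n = (s * fst b + t * fst c, s * snd b + t * snd c) \/
     n = (s * fst c + t * fst a, s * snd c + t * snd a)).
Proof.
  intros Hab Hbc Hca.
  assert (Hcone : forall p q, 0 < cross p q -> 0 <= cross n q -> 0 <= cross p n ->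
    exists s t, 0 <= s /\ 0 <= t /\ n = (s * fst p + t * fst q, s * snd p + t * snd q)).
  { intros p q Hpq H1 H2. exists (cross n q / cross p q), (cross p n / cross p q).
    repeat split; try (apply Rmult_le_pos; auto; left; apply Rinv_0_lt_compat; auto).
    rewrite (surjective_pairing n) at 1. f_equal; unfold cross in *; field; lra. }
  assert (Eanti : forall p, cross n p = - cross p n) by (intros; coords; ring).
  destruct (Rle_dec 0 (cross a n)), (Rle_dec 0 (cross b n)), (Rle_dec 0 (cross c n));
    try (destruct (Hcone a b) as (s & t & ? & ? & ?); auto; [rewrite Eanti; lra|exists s, t; auto]; fail);
    try (destruct (Hcone b c) as (s & t & ? & ? & ?); auto; [rewrite Eanti; lra|exists s, t; auto]; fail);
    try (destruct (Hcone c a) as (s & t & ? & ? & ?); auto; [rewrite Eanti; lra|exists s, t; auto]; fail).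
  (* What remains is all signs nonnegative or all negative; this relation forces zeros in the first
     case and excludes the second. *)
  all: assert (E1 : cross b c * cross a n + cross c a * cross b n + cross a b * cross c n = 0) by (coords; ring).
  - assert (Hb : cross b n = 0) by nra.
    destruct (Hcone a b) as (s & t & ? & ? & ?); auto; [rewrite Eanti; lra|exists s, t; auto].
  - nra.
Qed.

(* [1 = |n|^2 >= (t - s)^2] since [<u, v> >= -1], and [<n, x> <= (t - s) r]. *)
Lemma cone_cap_bound (u v x n : pt) (s t r : R) :
  0 < r -> dot u u = 1 -> dot v v = 1 -> dot n n = 1 -> 0 <= s -> 0 <= t ->
  n = (s * fst u + t * fst v, s * snd u + t * snd v) ->
  dot u x <= - r -> dot v x <= r -> dot n x <= r.
Proof.
  intros Hr Hu Hv Hn Hs Ht En Hux Hvx.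
  assert (E1 : dot n x = s * dot u x + t * dot v x) by (rewrite En; coords; ring).
  assert (E2 : dot n n = s ^ 2 * dot u u + t ^ 2 * dot v v + 2 * (s * t) * dot u v)
    by (rewrite En; coords; ring).
  rewrite Hn, Hu, Hv in E2.
  assert (E3 : dot (vsub u (- fst v, - snd v)) (vsub u (- fst v, - snd v)) = dot u u + dot v v + 2 * dot u v)
    by (coords; ring).
  pose proof (dot_self_nonneg (vsub u (- fst v, - snd v))).
  assert (0 <= s * t) by (apply Rmult_le_pos; auto).
  assert (0 <= s * t * (1 + dot u v)) by (apply Rmult_le_pos; lra).
  assert ((t - s) ^ 2 <= 1) by lra. assert (t - s <= 1) by nra.
  pose proof (Rmult_le_compat_l s _ _ Hs Hux). pose proof (Rmult_le_compat_l t _ _ Ht Hvx). nra.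
Qed.

(** If both fail, [common_cap] gives a cap of normal [n] with [X1] and [P], and one of normal [m]
    with [X2] and [P]. By [cone_cap_bound], [n] is in no cone with edge [u1] and [m] in none with
    edge [u2]. So [n] is in the cone of [u2] and [u3], and [m] in that of [u3] and [u1]; no [P] in
    the triangle lies in both caps. *)
Lemma aims_one_of_two (u1 u2 u3 X1 X2 P : pt) (r s : R) :
  0 < r -> r < s -> dot u1 u1 = 1 -> dot u2 u2 = 1 -> dot u3 u3 = 1 ->
  0 < cross u1 u2 -> 0 < cross u2 u3 -> 0 < cross u3 u1 ->
  dot u1 X1 <= - s -> dot u2 X1 <= r -> dot u3 X1 <= r ->
  dot u1 X2 <= r -> dot u2 X2 <= - s -> dot u3 X2 <= r ->
  dot u1 P <= r -> dot u2 P <= r -> dot u3 P <= r ->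
  aims r X1 P \/ aims r X2 P.
Proof.
  intros Hr Hrs E1 E2 E3 H12 H23 H31 H1X1 H2X1 H3X1 H1X2 H2X2 H3X2 H1P H2P H3P.
  assert (Hfar : forall u X, dot u u = 1 -> dot u X <= - s -> r ^ 2 < dot X X).
  { intros u X Hu HX. assert (E : dot u X ^ 2 + cross u X ^ 2 = dot u u * dot X X) by (coords; ring).
    rewrite Hu in E. pose proof (pow2_ge_0 (cross u X)).
    assert (0 < (- dot u X - r) * (- dot u X + r)) by (apply Rmult_lt_0_compat; lra).
    lra. }
  destruct (classic (aims r X1 P)) as [|A1]; auto.
  destruct (classic (aims r X2 P)) as [|A2]; auto. exfalso.
  apply common_cap in A1 as (n & En & HnX & HnP); eauto.
  apply common_cap in A2 as (m & Em & HmX & HmP); eauto.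
  destruct (cone_decomposition u1 u2 u3 n) as (a & b & Ha & Hb & [Hn|[Hn|Hn]]); auto.
  { apply (Rlt_not_le (dot n X1) r); auto; apply (cone_cap_bound u1 u2 X1 n a b r); auto; lra. }
  2: { rewrite Rplus_comm, (Rplus_comm (a * snd u3)) in Hn.
       apply (Rlt_not_le (dot n X1) r); auto; apply (cone_cap_bound u1 u3 X1 n b a r); auto; lra. }
  destruct (cone_decomposition u1 u2 u3 m) as (a' & b' & Ha' & Hb' & [Hm|[Hm|Hm]]); auto.
  { rewrite Rplus_comm, (Rplus_comm (a' * snd u1)) in Hm.
    apply (Rlt_not_le (dot m X2) r); auto; apply (cone_cap_bound u2 u1 X2 m b' a' r); auto; lra. }
  { apply (Rlt_not_le (dot m X2) r); auto; apply (cone_cap_bound u2 u3 X2 m a' b' r); auto; lra. }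
  (* Otherwise [cone_cap_bound], applied to [P] with [u3] as the far edge, gives [dot n P <= r]. *)
  assert (HP : - r < dot u3 P).
  { apply Rnot_le_lt; intros HP. rewrite Rplus_comm, (Rplus_comm (a * snd u2)) in Hn.
    apply (Rlt_not_le (dot n P) r); auto; apply (cone_cap_bound u3 u2 P n b a r); auto; lra. }
  (* [n] and [m] lie on different sides of [u3], and [P] would have to lie on both sides *)
  assert (Hside : forall k, dot k k = 1 -> r < dot k P -> 0 < cross u3 k * cross u3 P).
  { intros k Hk HkP.
    assert (E : dot k P = dot u3 k * dot u3 P + cross u3 k * cross u3 P).
    { transitivity (dot u3 u3 * dot k P); [rewrite E3; ring | coords; ring]. }
    assert (E' : dot u3 k ^ 2 + cross u3 k ^ 2 = 1).
    { transitivity (dot u3 u3 * dot k k); [coords; ring | rewrite E3, Hk; ring]. }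
    pose proof (pow2_ge_0 (cross u3 k)).
    assert (Hk1 : - 1 <= dot u3 k <= 1) by (split; nra).
    assert (dot u3 k * dot u3 P <= r) by
      (assert (0 <= (1 - dot u3 k) * (r + dot u3 P)) by (apply Rmult_le_pos; lra);
       assert (0 <= (1 + dot u3 k) * (r - dot u3 P)) by (apply Rmult_le_pos; lra); lra).
    lra. }
  pose proof (Hside n En HnP) as Sn. pose proof (Hside m Em HmP) as Sm.
  replace (cross u3 n) with (- (a * cross u2 u3)) in Sn by (rewrite Hn; coords; ring).
  replace (cross u3 m) with (b' * cross u3 u1) in Sm by (rewrite Hm; coords; ring).
  assert (0 <= a * cross u2 u3) by nra. assert (0 <= b' * cross u3 u1) by nra.
  destruct (Rle_dec 0 (cross u3 P)); nra.
Qed.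

(** * The angle at a far vertex and the circumradius *)

(** Each ray from [X] deviates from the direction of the origin by an angle of sine at most r / |X|,
    so the angle between them has cosine at least 1 - 2 r^2 / |X|^2. Angles are avoided by expanding
    the dot product along [X] and its normal; the tangent length [h] bounds the first part. *)
Lemma vertex_angle_bound (r : R) (X P Q : pt) :
  0 < r -> r ^ 2 < dot X X -> aims r X P -> aims r X Q ->
  dist P X * dist Q X * (dot X X - 2 * r ^ 2) <= dot X X * dot (vsub P X) (vsub Q X).
Proof.
  intros Hr HX [HP1 HP2] [HQ1 HQ2].
  pose proof (dist_sqr P X) as EP. pose proof (dist_sqr Q X) as EQ.
  pose proof (dist_nonneg P X) as HA. pose proof (dist_nonneg Q X) as HB.
  set (p := vsub P X) in *. set (q := vsub Q X) in *.
  set (A := dist P X) in *. set (B := dist Q X) in *.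
  assert (E : dot X X * dot p q = dot p X * dot q X + cross p X * cross q X) by (coords; ring).
  assert (Hone : forall v a, 0 <= a -> a ^ 2 = dot v v -> dot v X < 0 ->
    cross v X ^ 2 <= r ^ 2 * dot v v ->
    a * sqrt (dot X X - r ^ 2) <= - dot v X /\ - (r * a) <= cross v X <= r * a).
  { intros v a Ha Ea Hneg Hc. rewrite <- Ea in Hc.
    assert (Ev : dot v X ^ 2 + cross v X ^ 2 = dot v v * dot X X) by (coords; ring).
    rewrite <- Ea in Ev.
    pose proof (sqrt_pos (dot X X - r ^ 2)) as Hh.
    assert (Eh : sqrt (dot X X - r ^ 2) ^ 2 = dot X X - r ^ 2) by (apply pow2_sqrt; lra).
    assert (0 <= r * a) by nra.
    split.
    - apply Rsqr_incr_0_var; [unfold Rsqr; nra | lra].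
    - apply Rabs_le_inv.
      rewrite <- (Rabs_pos_eq (r * a)); auto. apply Rsqr_le_abs_0; unfold Rsqr; nra. }
  destruct (Hone p A) as [P1 P2]; auto. destruct (Hone q B) as [Q1 Q2]; auto.
  pose proof (sqrt_pos (dot X X - r ^ 2)) as Hh.
  assert (Eh : sqrt (dot X X - r ^ 2) ^ 2 = dot X X - r ^ 2) by (apply pow2_sqrt; lra).
  set (h := sqrt (dot X X - r ^ 2)) in *.
  assert (HAh : 0 <= A * h) by nra. assert (HBh : 0 <= B * h) by nra.
  assert ((A * h) * (B * h) <= dot p X * dot q X) by nra.
  assert (- ((r * A) * (r * B)) <= cross p X * cross q X).
  { assert (0 <= r * A) by nra. assert (0 <= r * B) by nra. nra. }
  rewrite E. replace (A * B * (dot X X - 2 * r ^ 2)) with (A * B * h ^ 2 - r * A * (r * B))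
    by (rewrite Eh; ring). nra.
Qed.

(* A weighted average of the squared distances from [c] to the three points, with the
   barycentric weights of the circumcenter, which are nonnegative as the triangle is acute. *)
Lemma circumradius_bound (P Q X c : pt) (rho : R) :
  let a := dist P X ^ 2 in let b := dist Q X ^ 2 in let k := dot (vsub P X) (vsub Q X) in
  0 <= rho -> 0 < a -> 0 < b -> 0 <= k -> a <= dist P Q ^ 2 -> b <= dist P Q ^ 2 ->
  dist c X <= rho -> dist c P <= rho -> dist c Q <= rho ->
  dist P Q ^ 2 * (a * b) <= 4 * rho ^ 2 * (a * b - k ^ 2).
Proof.
  intros a b k Hrho Ha Hb Hk HaD HbD HX HP HQ.
  assert (Hsq : forall Y, dist c Y <= rho -> dist c Y ^ 2 <= rho ^ 2)
    by (intros Y HY; apply pow_incr; pose proof (dist_nonneg c Y); lra).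
  apply Hsq in HX, HP, HQ. clear Hsq.
  assert (ED : dist P Q ^ 2 = a + b - 2 * k)
    by (unfold a, b, k; rewrite !dist_sqr; coords; ring).
  rewrite ED in *. clear ED.
  set (p := vsub P X) in *. set (q := vsub Q X) in *. set (z := vsub c X).
  assert (Ea : a = dot p p) by apply dist_sqr. assert (Eb : b = dot q q) by apply dist_sqr.
  assert (EX : dist c X ^ 2 = dot z z) by apply dist_sqr.
  assert (EP : dist c P ^ 2 = dot z z - 2 * dot z p + a).
  { rewrite Ea, dist_sqr. unfold z, p; coords; ring. }
  assert (EQ : dist c Q ^ 2 = dot z z - 2 * dot z q + b).
  { rewrite Eb, dist_sqr. unfold z, q; coords; ring. }
  rewrite EX in HX. rewrite EP in HP. rewrite EQ in HQ. clear EX EP EQ.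
  (* The Gram determinant of [p] and [q]. As [a] and [b] are at most [a + b - 2 * k], both are at
     least [2 * k], whence [G] is positive. *)
  set (G := a * b - k ^ 2).
  assert (HG : 0 < G) by (unfold G; assert (4 * k ^ 2 <= a * b) by nra; nra).
  (* Relative to [X], the circumcenter is W / (2 G). *)
  set (W := (b * (a - k) * fst p + a * (b - k) * fst q,
             b * (a - k) * snd p + a * (b - k) * snd q) : pt).
  assert (EW : dot W W = a * b * G * (a + b - 2 * k)).
  { transitivity ((b * (a - k)) ^ 2 * dot p p + (a * (b - k)) ^ 2 * dot q q
      + 2 * (b * (a - k)) * (a * (b - k)) * dot p q); [unfold W; coords; ring|].
    rewrite <- Ea, <- Eb. fold k. unfold G. ring. }
  assert (EzW : dot z W = b * (a - k) * dot z p + a * (b - k) * dot z q) by (unfold W; coords; ring).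
  pose proof (dot_self_nonneg (2 * G * fst z - fst W, 2 * G * snd z - snd W)) as Hsq.
  replace (dot (2 * G * fst z - fst W, 2 * G * snd z - snd W) (2 * G * fst z - fst W, 2 * G * snd z - snd W))
    with (4 * G ^ 2 * dot z z - 4 * G * dot z W + dot W W) in Hsq by (coords; ring).
  rewrite EW in Hsq.
  (* The weights of [X], [P], [Q] are [(a + b - 2 * k) * k], [b * (a - k)] and [a * (b - k)], of sum
     [2 * G]. *)
  assert (Hw : 2 * G * dot z z - 2 * dot z W + a * b * (a + b - 2 * k) <= 2 * G * rho ^ 2).
  { rewrite EzW.
    assert (0 <= (a + b - 2 * k) * k) by nra.
    assert (0 <= b * (a - k)) by nra. assert (0 <= a * (b - k)) by nra.
    pose proof (Rmult_le_compat_l _ _ _ H HX). pose proof (Rmult_le_compat_l _ _ _ H0 HP).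
    pose proof (Rmult_le_compat_l _ _ _ H1 HQ). unfold G. nra. }
  apply Rmult_le_reg_l with G; auto. nra.
Qed.

(** With x = D / (2 Rc) and C the inner root, squaring reduces the claim to x^2 s^2 <= 2 r^2 (1 +
    C), where x^2 = (1 - C)(1 + C). *)
Lemma width_bound_of_angle (r s D Rc : R) :
  0 < r -> 0 < D -> D <= 2 * Rc ->
  (1 - sqrt (1 - (D / (2 * Rc)) ^ 2)) * s ^ 2 <= 2 * r ^ 2 ->
  s <= r * ((2 * sqrt 2 * Rc / D) * sqrt (1 + sqrt (1 - (D / (2 * Rc)) ^ 2))).
Proof.
  intros Hr HD HR.
  assert (Eq : D / (2 * Rc) * (2 * Rc) = D) by (field; lra).
  set (x := D / (2 * Rc)) in *.
  assert (Hx0 : 0 < x) by (apply Rdiv_lt_0_compat; lra).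
  assert (Hx1 : x <= 1) by nra.
  replace (2 * sqrt 2 * Rc / D) with (sqrt 2 / x) by (rewrite <- Eq; field; lra).
  pose proof (sqrt_pos (1 - x ^ 2)) as HC.
  assert (EC : sqrt (1 - x ^ 2) ^ 2 = 1 - x ^ 2) by (apply pow2_sqrt; nra).
  set (C := sqrt (1 - x ^ 2)) in *. intros Hs.
  pose proof (sqrt_pos (1 + C)) as HT. assert (ET : sqrt (1 + C) ^ 2 = 1 + C) by (apply pow2_sqrt; lra).
  pose proof (sqrt_pos 2) as H2. assert (E2 : sqrt 2 ^ 2 = 2) by (apply pow2_sqrt; lra).
  set (T := sqrt (1 + C)) in *. set (S := sqrt 2) in *.
  apply Rmult_le_reg_l with x; auto.
  replace (x * (r * (S / x * T))) with (r * S * T) by (field; lra).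
  apply Rsqr_incr_0_var; [|assert (0 <= r * S) by nra; nra].
  unfold Rsqr. replace (r * S * T * (r * S * T)) with (r ^ 2 * S ^ 2 * T ^ 2) by ring.
  rewrite E2, ET. replace (x * s * (x * s)) with (x ^ 2 * s ^ 2) by ring.
  replace (x ^ 2) with ((1 - C) * (1 + C)) by (transitivity (1 - C ^ 2); [ring | rewrite EC; ring]).
  nra.
Qed.

(** * Far points of the body and the final estimate *)

(** The supporting line of normal [u] is at signed distance [r] from [c], and the opposite one is at
    distance at least [w] from it; [X] is a point where the latter touches [K]. *)
Lemma far_point (K : pt -> Prop) (c u : pt) (r w : R) :
  closed K -> bounded K -> 0 < r -> is_minimal_width K w ->
  (forall q, dist c q <= r -> K q) -> contact K c r u ->
  exists X, K X /\ dot u (vsub X c) <= - (w - r).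
Proof.
  intros HC HB Hr [Hw _] Hball [Hu Hsup].
  pose proof (ball_boundary_point K c u r) as Htop.
  pose proof (ball_boundary_point K c (- fst u, - snd u) r) as Hbot.
  assert (Hu' : dot (- fst u, - snd u) (- fst u, - snd u) = 1) by (rewrite <- Hu; coords; ring).
  specialize (Htop ltac:(lra) Hball Hu). specialize (Hbot ltac:(lra) Hball Hu').
  destruct (min_attained K (fun x => dot x u) (Rabs (fst u) + Rabs (snd u)))
    as (X & HX & Hmin); auto.
  { eexists; apply Htop. }
  { apply dot_lipschitz_const. }
  { apply dot_lipschitz. }
  exists X; split; auto.
  (* The bottom point of the ball shows that the two supporting lines are distinct. *)
  assert (Hgap : dot X u <= dot c u - r).
  { specialize (Hmin _ Hbot). cbv beta in Hmin.
    replace (dot c u - r) with (dot c u - r * dot u u) by (rewrite Hu; ring).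
    eapply Rle_trans; [apply Hmin|]. right; coords; ring. }
  assert (w <= Rabs (dot c u + r - dot X u)) as Hle.
  { apply Hw. exists u, (dot c u + r), (dot X u). split; [|split; [|split]].
    - split; [auto|split].
      + intros x Hx. specialize (Hsup x Hx). rewrite dot_vsub, !(dot_comm u) in Hsup. lra.
      + exists (fst c + r * fst u, snd c + r * snd u). split; auto.
        transitivity (dot c u + r * dot u u); [coords; ring | rewrite Hu; ring].
    - assert (Eneg : forall x, dot x (- fst u, - snd u) = - dot x u) by (intros; coords; ring).
      split; [auto|split].
      + intros x Hx. rewrite Eneg. specialize (Hmin x Hx). cbv beta in Hmin. lra.
      + exists X. split; auto.
    - lra.
    - reflexivity. }
  rewrite Rabs_pos_eq in Hle by lra. rewrite dot_vsub, !(dot_comm u). lra.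
Qed.

Lemma vertex_aiming_at_both (K : pt -> Prop) (c P Q : pt) (r w : R) :
  convex_body K -> 0 < r -> is_inradius K r -> is_minimal_width K w ->
  (forall q, dist c q <= r -> K q) -> r < w - r -> K P -> K Q ->
  exists X, K X /\ (w - r) ^ 2 <= dot (vsub X c) (vsub X c) /\
    aims r (vsub X c) (vsub P c) /\ aims r (vsub X c) (vsub Q c).
Proof.
  intros (HV & HC & HB & _) Hr Hin Hw Hball Hs HP HQ.
  destruct (antipodal_or_spanning_triple (contact K c r))
    as [(a & b & Ha & Hb & E1 & E2)|(a & b & d & Ha & Hb & Hd & Hab & Hbd & Hda)].
  - intros u Hu; apply Hu.
  - apply closed_contact_halfplane.
  - intros v; apply contact_in_halfplane; auto.
  (* Opposite contact normals confine [K] to a strip of width [2 * r], against [r < w - r]. *)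
  - destruct (far_point K c a r w) as (X & HX & HaX); auto.
    destruct Hb as [_ Hb]. specialize (Hb X HX).
    assert (dot a (vsub X c) = - dot b (vsub X c)) by (unfold dot; rewrite E1, E2; ring). lra.
  - assert (Hfar : forall u, contact K c r u -> exists X, K X /\ dot u (vsub X c) <= - (w - r) /\
      (w - r) ^ 2 <= dot (vsub X c) (vsub X c)).
    { intros u Hu. destruct (far_point K c u r w) as (X & HX & HuX); auto.
      exists X; repeat split; auto. destruct Hu as [Hu _].
      assert (E : dot u (vsub X c) ^ 2 + cross u (vsub X c) ^ 2 = dot u u * dot (vsub X c) (vsub X c))
        by (unfold dot, cross; ring).
      rewrite Hu in E. pose proof (pow2_ge_0 (cross u (vsub X c))).
      assert (0 <= (- dot u (vsub X c) - (w - r)) * (- dot u (vsub X c) + (w - r)))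
        by (apply Rmult_le_pos; lra). lra. }
    destruct (Hfar a Ha) as (X1 & HX1 & HaX1 & HN1), (Hfar b Hb) as (X2 & HX2 & HbX2 & HN2),
      (Hfar d Hd) as (X3 & HX3 & HdX3 & HN3).
    destruct Ha as [Ea Ha], Hb as [Eb Hb], Hd as [Ed Hd].
    assert (Htwo : forall Y, K Y ->
       (aims r (vsub X1 c) (vsub Y c) \/ aims r (vsub X2 c) (vsub Y c)) /\
       (aims r (vsub X2 c) (vsub Y c) \/ aims r (vsub X3 c) (vsub Y c)) /\
       (aims r (vsub X3 c) (vsub Y c) \/ aims r (vsub X1 c) (vsub Y c))).
    { intros Y HY. split; [|split].
      - apply (aims_one_of_two a b d) with (w - r); auto.
      - apply (aims_one_of_two b d a) with (w - r); auto.
      - apply (aims_one_of_two d a b) with (w - r); auto. }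
    destruct (Htwo P HP) as (P1 & P2 & P3), (Htwo Q HQ) as (Q1 & Q2 & Q3).
    (* At most one of the three points fails for [P] and at most one for [Q]. *)
    assert ((aims r (vsub X1 c) (vsub P c) /\ aims r (vsub X1 c) (vsub Q c)) \/
            (aims r (vsub X2 c) (vsub P c) /\ aims r (vsub X2 c) (vsub Q c)) \/
            (aims r (vsub X3 c) (vsub P c) /\ aims r (vsub X3 c) (vsub Q c))) as [H|[H|H]] by tauto.
    + exists X1; auto.
    + exists X2; auto.
    + exists X3; auto.
Qed.

Theorem theorem3p4 (K : pt -> Prop) (r w D Rc : R) :
  convex_body K ->
  is_inradius K r -> is_minimal_width K w ->
  is_diameter K D -> is_circumradius K Rc ->
  w <= r * (1 + (2 * sqrt 2 * Rc / D) * sqrt (1 + sqrt (1 - (D / (2 * Rc)) ^ 2))).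
Proof.
  intros HK Hin Hw HD HR.
  pose proof HK as (HV & HC & HB & (o & e & He & Ho)).
  assert (Hr : 0 < r).
  { apply Rlt_le_trans with (e / 2); [lra|]. apply Hin. split; [lra|].
    exists o; intros q Hq; apply Ho; lra. }
  destruct (inball_attained K r) as (c & Hball); auto.
  destruct (diameter_attained K D) as (P & Q & HP & HQ & EPQ); auto.
  destruct HD as [HDub _], HR as [_ HRglb].
  assert (HPQ : forall x y, K x -> K y -> dist x y <= D) by (intros; apply HDub; eauto).
  assert (HDpos : 0 < D).
  { set (t := (fst c + r * 1, snd c + r * 0) : pt).
    assert (dist c t = r).
    { unfold dist, t; cbn [fst snd].
      replace ((fst c - (fst c + r * 1)) ^ 2 + (snd c - (snd c + r * 0)) ^ 2) with (r ^ 2) by ring.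
      apply sqrt_pow2; lra. }
    assert (dist c c <= r) by (pose proof (dist_triangle c t c); unfold dist at 1;
      rewrite !Rminus_diag; replace (0 ^ 2 + 0 ^ 2) with 0 by ring; rewrite sqrt_0; lra).
    specialize (HPQ c t (Hball c ltac:(auto)) (Hball t ltac:(lra))). lra. }
  assert (HDR : D <= 2 * Rc).
  { enough (D / 2 <= Rc) by lra. apply HRglb. intros rho [Hrho [z Hz]].
    pose proof (dist_triangle P Q z). rewrite (dist_comm P z) in *.
    pose proof (Hz P HP). pose proof (Hz Q HQ). lra. }
  enough (w - r <= r * ((2 * sqrt 2 * Rc / D) * sqrt (1 + sqrt (1 - (D / (2 * Rc)) ^ 2)))) by lra.
  assert (Hx : 0 < D / (2 * Rc) <= 1).
  { split; [apply Rdiv_lt_0_compat; lra|]. apply Rmult_le_reg_r with (2 * Rc); [lra|].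
    replace (D / (2 * Rc) * (2 * Rc)) with D by (field; lra). lra. }
  pose proof (sqrt_pos (1 - (D / (2 * Rc)) ^ 2)) as HC0.
  assert (HC1 : sqrt (1 - (D / (2 * Rc)) ^ 2) <= 1) by
    (rewrite <- sqrt_1 at 2; apply sqrt_le_1_alt; nra).
  set (C := sqrt (1 - (D / (2 * Rc)) ^ 2)) in *.
  destruct (Rle_dec (w - r) 0) as [Hneg|Hpos].
  { eapply Rle_trans; [apply Hneg|]. apply Rmult_le_pos; [lra|].
    apply Rmult_le_pos; [|apply sqrt_pos].
    pose proof (sqrt_pos 2).
    apply Rmult_le_pos; [nra | left; apply Rinv_0_lt_compat; lra]. }
  apply width_bound_of_angle; auto. fold C.
  (* The small case follows from [0 <= C]; in the other one the angle at [X] will not be obtuse. *)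
  destruct (Rle_dec ((w - r) ^ 2) (2 * r ^ 2)) as [Hsmall|Hlarge]; [nra|].
  assert (Hs : r < w - r) by nra.
  destruct (vertex_aiming_at_both K c P Q r w) as (X & HX & HN & AP & AQ); auto.
  assert (HrN : r ^ 2 < dot (vsub X c) (vsub X c)) by nra.
  pose proof (vertex_angle_bound r _ _ _ Hr HrN AP AQ) as Hangle.
  assert (Esub : forall Y Z, vsub (vsub Y c) (vsub Z c) = vsub Y Z)
    by (intros; unfold vsub; cbn [fst snd]; f_equal; ring).
  assert (Edist : forall Y Z, dist (vsub Y c) (vsub Z c) = dist Y Z)
    by (intros; unfold dist, vsub; cbn [fst snd]; do 2 f_equal; ring).
  rewrite !Esub, !Edist in Hangle.
  assert (Hpos' : forall Y, aims r (vsub X c) (vsub Y c) -> 0 < dist Y X).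
  { intros Y [HY _]. rewrite Esub in HY. pose proof (dist_nonneg Y X). pose proof (dist_sqr Y X) as E.
    destruct (Req_dec (dist Y X) 0) as [H0|]; [|lra]. exfalso.
    rewrite H0 in E. unfold dot in E, HY.
    assert (fst (vsub Y X) = 0) as F1 by nra. assert (snd (vsub Y X) = 0) as F2 by nra.
    rewrite F1, F2 in HY. lra. }
  pose proof (Hpos' P AP) as HA. pose proof (Hpos' Q AQ) as HB'.
  pose proof (HPQ P X HP HX) as HAD. pose proof (HPQ Q X HQ HX) as HBD.
  pose proof (circumradius_bound P Q X) as Hcirc. cbv zeta in Hcirc. rewrite EPQ in Hcirc.
  set (A := dist P X) in *. set (B := dist Q X) in *.
  set (k := dot (vsub P X) (vsub Q X)) in *. set (N := dot (vsub X c) (vsub X c)) in *.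
  assert (HAB : 0 < A * B) by (apply Rmult_lt_0_compat; auto).
  assert (Hk : 0 <= k).
  { apply Rmult_le_reg_l with N; [nra|]. rewrite Rmult_0_r. eapply Rle_trans; [|apply Hangle].
    apply Rmult_le_pos; lra. }
  assert (HAD2 : A ^ 2 <= D ^ 2) by nra. assert (HBD2 : B ^ 2 <= D ^ 2) by nra.
  set (G := A ^ 2 * B ^ 2 - k ^ 2) in *.
  set (M := D ^ 2 * (A ^ 2 * B ^ 2)) in *.
  assert (HM : 0 < M) by (unfold M; repeat apply Rmult_lt_0_compat; try apply pow_lt; lra).
  assert (Hrho : forall rho, 0 <= rho /\ (exists z, forall q, K q -> dist z q <= rho) ->
                 M <= 4 * rho ^ 2 * G).
  { intros rho [Hrho [z Hz]]. apply (Hcirc z); auto; apply pow_lt; auto. }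
  (* If [G <= 0], then [Hrho] leaves no admissible radius, so even [Rc + 1] is a lower bound. *)
  assert (HG : 0 < G).
  { apply Rnot_le_lt; intros HG. assert (Rc + 1 <= Rc); [|lra].
    apply HRglb. intros rho H. specialize (Hrho rho H). pose proof (pow2_ge_0 rho). nra. }
  assert (HRk : M <= 4 * Rc ^ 2 * G).
  { pose proof (sqrt_pos (M / (4 * G))) as H0.
    assert (E : sqrt (M / (4 * G)) ^ 2 * (4 * G) = M).
    { rewrite pow2_sqrt; [field; lra|]. left; apply Rdiv_lt_0_compat; lra. }
    (* By [Hrho] this circumradius of the triangle is a lower bound of all admissible radii. *)
    assert (sqrt (M / (4 * G)) <= Rc).
    { apply HRglb. intros rho H. pose proof (Hrho rho H) as Hle. destruct H as [H _].
      rewrite <- E in Hle. apply Rsqr_incr_0_var; auto. unfold Rsqr.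
      apply Rmult_le_reg_r with (4 * G); lra. }
    assert (sqrt (M / (4 * G)) ^ 2 <= Rc ^ 2) by (apply pow_incr; lra).
    rewrite <- E. nra. }
  assert (Ekap : k / (A * B) * (A * B) = k) by (field; lra).
  assert (Hkap0 : 0 <= k / (A * B)) by (apply Rmult_le_pos; auto; left; apply Rinv_0_lt_compat; auto).
  (* The cosine of the angle at [X] in the triangle [P], [Q], [X]. *)
  set (kap := k / (A * B)) in *.
  (* Divided by [4 * Rc ^ 2 * (A * B) ^ 2], [HRk] reads (D / (2 Rc))^2 <= 1 - kap^2. *)
  assert (Hcos : kap <= C).
  { rewrite <- (sqrt_pow2 kap) by auto. apply sqrt_le_1_alt.
    set (x := D / (2 * Rc)) in *. assert (Ex : D = x * (2 * Rc)) by (unfold x; field; lra).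
    assert (0 < 4 * Rc ^ 2 * (A * B) ^ 2)
      by (repeat apply Rmult_lt_0_compat; try apply pow_lt; try lra).
    apply Rmult_le_reg_l with (4 * Rc ^ 2 * (A * B) ^ 2); auto.
    unfold M, G in HRk. rewrite <- Ekap, Ex in HRk. lra. }
  assert (Hkap : (1 - kap) * N <= 2 * r ^ 2).
  { apply Rmult_le_reg_l with (A * B); auto. rewrite <- Ekap in Hangle. lra. }
  assert ((1 - C) * (w - r) ^ 2 <= (1 - C) * N) by (apply Rmult_le_compat_l; lra).
  assert ((1 - C) * N <= (1 - kap) * N) by (apply Rmult_le_compat_r; nra).
  lra.
Qed.
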